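(* Let $(\Sigma,\sigma)$ be a topologically mixing one-sided Markov shift over a finite alphabet. Every weak Gibbs measure $\mu$ for a continuous potential $\phi:\Sigma\to\mathbb{R}$ is a Gibbs measure for some asymptotically additive sequence $\Psi=(\psi_n)_n$ of continuous functions on $\Sigma$.
   Context: Markov shift: given a finite alphabet $\mathcal{A}$ (a finite set of integers) and a $0$-$1$ matrix $T=(t_{ij})_{\mathcal{A}\times\mathcal{A}}$, set $\Sigma=\{\omega\in\mathcal{A}^{\mathbb{N}}: t_{\omega_i\omega_{i+1}}=1 \text{ for every } i\in\mathbb{N}\}$, with shift map $\sigma(\omega_1\omega_2\dots)=(\omega_2\omega_3\dots)$. It is topologically mixing if there is a positive integer $l$ such that all entries of $T^l$ are strictly positive. Cylinders of length $n$: $C_{i_1\cdots i_n}=\{\omega\in\Sigma:\omega_j=i_j,\ 1\le j\le n\}$; they generate the topology of $\Sigma$, also induced by the metric $d(\omega,\kappa)=\sum_{i\ge1}|\omega_i-\kappa_i|/2^i$. For $\rho:\Sigma\to\mathbb{R}$, $S_n\rho=\sum_{j=0}^{n-1}\rho\circ\sigma^j$. A Borel probability measure $\mu$ on $\Sigma$ (not necessarily $\sigma$-invariant) is a weak Gibbs measure for the potential $\phi$ if there exist $P\in\mathbb{R}$ and positive reals $K(n)$ with $\lim_{n\to\infty}\frac{\log K(n)}{n}=0$ such that for every $n\in\mathbb{N}$, every cylinder $C_{i_1\dots i_n}$ and every $\omega\in C_{i_1\dots i_n}$, $$\frac1{K(n)}\le\frac{\mu(C_{i_1\dots i_n})}{\exp(S_n\phi(\omega)-nP)}\le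 K(n).$$ A sequence $\Psi=(\psi_n)_n$ of continuous functions $\psi_n:\Sigma\to\mathbb{R}$ is asymptotically additive if for every $\epsilon>0$ there is a continuous function $\rho_\epsilon:\Sigma\to\mathbb{R}$ with $\limsup_{n\to\infty}\frac1n\|\psi_n-S_n\rho_\epsilon\|<\epsilon$, where $\|\cdot\|$ is the supremum norm. Topological pressure: a subset $E\subset\Sigma$ is $(n,\epsilon)$-separated if $\max_{0\le i\le n-1}d(\sigma^i\omega,\sigma^i\kappa)>\epsilon$ for all distinct $\omega,\kappa\in E$. Put $P(\Psi,n,\epsilon)=\sup\{\sum_{\omega\in E}\exp(\psi_n(\omega)): E\subset\Sigma \text{ is } (n,\epsilon)\text{-separated}\}$ and $P(\Psi)=\lim_{\epsilon\to0}\limsup_{n\to\infty}\frac1n\log P(\Psi,n,\epsilon)$. A Borel probability measure $\mu$ is a Gibbs measure for the asymptotically additive sequence $\Psi$ if there is a constant $K>0$ such that for every $n\in\mathbb{N}$, every cylinder $C_{i_1\dots i_n}$ and every $\omega\in C_{i_1\dots i_n}$, $$\frac1{K}\le\frac{\mu(C_{i_1\dots i_n})}{\exp(\psi_n(\omega)-nP(\Psi))}\le K.$$ *)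

(* Defs.v *)
From HB Require Import structures.
From mathcomp Require Import all_boot all_order all_algebra finmap.
From mathcomp Require Import all_classical all_reals all_analysis.

Set Implicit Arguments.
Unset Strict Implicit.
Unset Printing Implicit Defensive.

Import Order.TTheory GRing.Theory Num.Theory.
Import numFieldNormedType.Exports.

Local Open Scope classical_set_scope.
Local Open Scope ring_scope.

(* The rows and columns of a matrix in 'M_#|{: A}| are indexed by the alphabet A
   through the enumeration enum_rank. *)
Definition entry (A : {fset int}) (T : 'M[nat]_#|{: A}|) (a b : A) : nat :=
  T (enum_rank a) (enum_rank b).

Definition zero_one (A : {fset int}) (T : 'M[nat]_#|{: A}|) :=
  forall a b : A, entry T a b = 0%N \/ entry T a b = 1%N.

Definition topologically_mixing (A : {fset int}) (T : 'M[nat]_#|{: A}|) :=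
  exists2 l : nat, (0 < l)%N & forall a b : A, (0 < entry (T ^+ l) a b)%N.

(* Coordinates are numbered from 0: coord w i is the letter usually written
   w_(i+1). *)
Record markov_shift (A : {fset int}) (T : 'M[nat]_#|{: A}|) := MarkovShift {
  coord :> nat -> A;
  coord_adm : forall i, entry T (coord i) (coord i.+1) = 1%N }.

Definition shift_map (A : {fset int}) (T : 'M[nat]_#|{: A}|) (w : markov_shift T) :
    markov_shift T :=
  MarkovShift (fun i => coord_adm w i.+1).

(* The cylinder of the finite word s, of length size s. *)
Definition cylinder (A : {fset int}) (T : 'M[nat]_#|{: A}|) (s : seq A) :
    set (markov_shift T) :=
  [set w | mkseq w (size s) = s].

HB.instance Definition _ (A : {fset int}) (T : 'M[nat]_#|{: A}|) :=
  gen_eqMixin (markov_shift T).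
HB.instance Definition _ (A : {fset int}) (T : 'M[nat]_#|{: A}|) :=
  gen_choiceMixin (markov_shift T).
HB.instance Definition _ (A : {fset int}) (T : 'M[nat]_#|{: A}|) :=
  isSubBaseTopological.Build (markov_shift T) (range (@cylinder A T)) id.

(* A measurableType must be pointed, so the Borel space is built on a copy of
   the shift space carrying a base point w0. The sigma-algebra does not depend
   on w0, and w0 exists as soon as there is a probability measure. *)
Definition pointed_shift (A : {fset int}) (T : 'M[nat]_#|{: A}|)
  (w0 : markov_shift T) : Type := markov_shift T.

HB.instance Definition _ (A : {fset int}) (T : 'M[nat]_#|{: A}|)
    (w0 : markov_shift T) :=
  Choice.on (pointed_shift w0).
HB.instance Definition _ (A : {fset int}) (T : 'M[nat]_#|{: A}|)
    (w0 : markov_shift T) :=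
  isPointed.Build (pointed_shift w0) w0.

Definition borel_shift (A : {fset int}) (T : 'M[nat]_#|{: A}|)
    (w0 : markov_shift T) :=
  @g_sigma_algebraType (pointed_shift w0) (@open (markov_shift T)).

Section Potentials.
Variables (R : realType) (A : {fset int}) (T : 'M[nat]_#|{: A}|).
Implicit Types (rho : markov_shift T -> R) (psi : nat -> markov_shift T -> R).

Definition birkhoff (n : nat) rho (w : markov_shift T) : R :=
  \sum_(j < n) rho (iter j (@shift_map A T) w).

(* Only applied to continuous functions, which are bounded since the shift
   space is compact. *)
Definition supnorm rho : R := sup (range (fun w => `|rho w|)).

(* In sequences of functions psi only the terms psi n with n >= 1 matter. *)
Definition asymptotically_additive psi :=
  (forall n, (0 < n)%N -> continuous (psi n)) /\
  (forall eps : R, 0 < eps ->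
     exists2 rho, continuous rho &
       (limn_esup (fun n =>
          (n%:R^-1 * supnorm (psi n \- birkhoff n rho))%:E) < eps%:E)%E).

Definition shift_dist (w v : markov_shift T) : R :=
  limn (series (fun i => `|fsval (w i) - fsval (v i)|%:~R / 2 ^+ i.+1 : R)).

Definition separated (n : nat) (eps : R) : set (set (markov_shift T)) :=
  [set E | forall w v, E w -> E v -> w <> v ->
     eps < \big[Num.max/0]_(i < n)
             shift_dist (iter i (@shift_map A T) w)
                        (iter i (@shift_map A T) v)].

Definition pressure_at psi (n : nat) (eps : R) : \bar R :=
  ereal_sup [set \esum_(w in E) (expR (psi n w))%:E | E in separated n eps].

Definition pressure psi : \bar R :=
  lim ((fun eps : R => limn_esup (fun n =>
          (n%:R^-1)%:E * lne (pressure_at psi n eps))%E) @ 0^'+).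

Definition weak_gibbs (w0 : markov_shift T)
    (mu : probability (borel_shift w0) R) (phi : markov_shift T -> R) :=
  exists (P : R) (K : nat -> R),
    [/\ forall n, (0 < n)%N -> 0 < K n,
        ln (K n) / n%:R @[n --> \oo] --> (0 : R) &
        forall (n : nat) (s : seq A) (w : markov_shift T),
          (0 < n)%N -> size s = n -> cylinder s w ->
          (K n)^-1 <= fine (mu (@cylinder A T s)) /
                      expR (birkhoff n phi w - n%:R * P) <= K n].

(* The pressure is an extended real a priori; its finiteness is implicit in
   the exponent psi_n(w) - n P(psi). *)
Definition gibbs (w0 : markov_shift T)
    (mu : probability (borel_shift w0) R) psi :=
  pressure psi \is a fin_num /\
  exists2 K : R, 0 < K &
    forall (n : nat) (s : seq A) (w : markov_shift T),
      (0 < n)%N -> size s = n -> cylinder s w ->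
      K^-1 <= fine (mu (@cylinder A T s)) /
              expR (psi n w - n%:R * fine (pressure psi)) <= K.

End Potentials.

(* Main.v *)
Require Import Defs.
From HB Require Import structures.
From mathcomp Require Import all_boot all_order all_algebra finmap.
From mathcomp Require Import all_classical all_reals all_analysis.
From mathcomp Require Import ring lra.

Set Implicit Arguments.
Unset Strict Implicit.
Unset Printing Implicit Defensive.

Import Order.TTheory GRing.Theory Num.Theory.
Import numFieldNormedType.Exports.

Local Open Scope classical_set_scope.
Local Open Scope ring_scope.

(** Take psi_n(w) = log mu(C_n(w)), where C_n(w) is the n-cylinder of w. The weak
    Gibbs bounds say that psi_n is within log K(n) = o(n) of S_n(phi - P), so
    (psi_n) is asymptotically additive, and mu(C_n(w)) = exp(psi_n(w)), so mu is
    Gibbs with constant 1 as soon as the pressure of (psi_n) vanishes. For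
    eps < 1/2 one point in each n-cylinder is an (n, eps)-separated set, of total
    weight 1; conversely an (n, eps)-separated set has at most one point in each
    (n+m)-cylinder, with m depending only on eps, so its total weight is at most
    |A|^m. Hence the pressure is 0. *)

(** * Words and cylinders *)

Section Shift.
Variables (A : {fset int}) (T : 'M[nat]_#|{: A}|).
Implicit Types (w v : markov_shift T) (s : seq A).

Lemma iter_shift i w j : iter i (@shift_map A T) w j = w (i + j)%N.
Proof. by elim: i w j => [//|i IH] w j; rewrite iterS /= IH addnS. Qed.

Lemma open_cylinder s : open (@cylinder A T s).
Proof.
exists [set @cylinder A T s]; last by rewrite bigcup_set1.
by move=> _ ->; apply: finI_from1; exists s.
Qed.

Lemma eq_mkseqP n w v :
  mkseq w n = mkseq v n <-> (forall i, (i < n)%N -> w i = v i).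
Proof.
split=> [e i ltin|e].
  by rewrite -(nth_mkseq (w 0%N) w ltin) e nth_mkseq.
by apply/eq_in_map => i; rewrite mem_iota => /e.
Qed.

Lemma cylinder_mkseq w n : cylinder (mkseq w n) w.
Proof. by rewrite /cylinder /= size_mkseq. Qed.

Definition initial_word n w : n.-tuple A := [tuple of mkseq w n].

End Shift.

(** * Sums indexed by a finite type *)

Section EsumFin.
Variables (R : realType) (I : finType).

Lemma esum_setT_fin (f : I -> R) : (forall i, 0 <= f i) ->
  (\esum_(i in [set: I]) (f i)%:E = (\sum_i f i)%:E)%E.
Proof.
move=> f0; rewrite esum_fset; [|exact: finite_finset|by move=> i _; rewrite lee_fin].
have -> : [set: I] = [set` index_enum I].
  by apply/seteqP; split=> i //= _; rewrite mem_index_enum.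
by rewrite -fsbig_seq ?index_enum_uniq// sumEFin.
Qed.

(** Serves to bound the weight of a separated set whose points are coded injectively by finitely
    many words. *)
Lemma esum_inj_le (X : choiceType) (E : set X) (q : X -> I) (f : I -> R) :
  (forall i, 0 <= f i) -> set_inj E q ->
  (\esum_(x in E) (f (q x))%:E <= (\sum_i f i)%:E)%E.
Proof.
move=> f0 qinj; rewrite -(esum_image _ _ (fun i => (f i)%:E))//.
rewrite -esum_setT_fin// esum_mkcond; apply: le_esum => i _.
by case: ifP => // _; rewrite lee_fin.
Qed.

End EsumFin.

(** * The metric compared with agreement of coordinates *)

Section Distance.
Variables (R : realType) (A : {fset int}) (T : 'M[nat]_#|{: A}|).
Implicit Types (w v : markov_shift T).

Let term w v i : R := `|fsval (w i) - fsval (v i)|%:~R / 2 ^+ i.+1.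

Let diam : R := \big[Num.max/0]_(p : A * A) `|fsval p.1 - fsval p.2|%:~R.

Let term_ge0 w v i : 0 <= term w v i.
Proof. by rewrite divr_ge0 ?exprn_ge0// ler0z. Qed.

Let diam_ge0 : 0 <= diam.
Proof. exact: bigmax_ge_id. Qed.

(* diam * (2 ^- m - 2 ^- n) is the geometric sum of diam / 2 ^+ i.+1 over
   m <= i < n, which makes the induction on n go through. *)
Let series_le w v m n : (forall i, (i < m)%N -> w i = v i) ->
  series (term w v) n <= diam * (2 ^- m - 2 ^- maxn m n).
Proof.
move=> e; elim: n => [|n IH].
  by rewrite seriesEnat /= big_geq// maxn0 subrr mulr0.
rewrite seriesSr; case: (ltnP n m) => nm.
  rewrite {2}/term (e _ nm) subrr normr0 mul0r addr0.
  by move: IH; rewrite (maxn_idPl _) 1?ltnW// (maxn_idPl _).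
rewrite (maxn_idPr _) ?leqW//; move: IH; rewrite (maxn_idPr _)// => IH.
have tle : term w v n <= diam * 2 ^- n.+1.
  rewrite ler_wpM2r ?invr_ge0 ?exprn_ge0//.
  exact: (le_bigmax _ (fun p : A * A => `|fsval p.1 - fsval p.2|%:~R : R) (w n, v n)).
apply: (le_trans (lerD IH tle)).
have -> : 2 ^- n = 2 ^- n.+1 + 2 ^- n.+1 :> R by rewrite exprS; field.
by rewrite -mulrDr ler_wpM2l//; lra.
Qed.

Let series_nd w v : nondecreasing_seq (series (term w v)).
Proof. exact: (nondecreasing_series (fun i _ _ => term_ge0 w v i)). Qed.

Let is_cvg_term w v : cvgn (series (term w v)).
Proof.
apply: nondecreasing_is_cvgn => //.
exists diam => _ [n _ <-].
have agree0 i : (i < 0)%N -> w i = v i by [].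
apply: (le_trans (series_le n agree0)).
by rewrite expr0 invr1 max0n ler_piMr// gerBl invr_ge0 exprn_ge0.
Qed.

(** The tail of the series is dominated by a geometric one. Since [D] is uniform in [m] and in the
    points, a scale [eps] alone determines how many common letters suffice. *)
Lemma shift_dist_agree : exists2 D : R, 0 <= D &
  forall m w v, (forall i, (i < m)%N -> w i = v i) -> shift_dist R w v <= D / 2 ^+ m.
Proof.
exists diam => // m w v e.
apply: limr_le; first exact: is_cvg_term.
apply: nearW => n.
apply: (le_trans (series_le n e)).
by rewrite ler_wpM2l// gerBl invr_ge0 exprn_ge0.
Qed.

(** Distinct integers differ by at least 1, so the first term of the series is already at least
    1/2. *)
Lemma shift_dist_disagree w v : w 0%N != v 0%N -> 2^-1 <= shift_dist R w v.
Proof.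
move=> ne; have /(_ 1%N) := nondecreasing_cvgn_le (series_nd w v) (@is_cvg_term w v).
apply: le_trans; rewrite seriesEnat /= big_nat1 /term expr1.
rewrite ler_peMl ?invr_ge0// ler1z -gtz0_ge1 normr_gt0 subr_eq0.
by apply: contra ne => /eqP/val_inj ->.
Qed.

End Distance.

(** * Cylinder masses and the pressure of their logarithms *)

Section Mass.
Variables (R : realType) (A : {fset int}) (T : 'M[nat]_#|{: A}|).
Variables (w0 : markov_shift T) (mu : probability (borel_shift w0) R).

Lemma measurable_cylinder (s : seq A) :
  measurable (@cylinder A T s : set (borel_shift w0)).
Proof. by apply: sub_sigma_algebra; exact: open_cylinder. Qed.

Lemma cylinder_mass_ge0 (s : seq A) : 0 <= fine (mu (@cylinder A T s)).
Proof. by rewrite fine_ge0. Qed.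

(** The cylinders of length [n] partition the space; words that occur in no point give empty
    cylinders. *)
Lemma sum_cylinder_mass n : \sum_(t : n.-tuple A) fine (mu (@cylinder A T t)) = 1.
Proof.
apply: EFin_inj; rewrite -esum_setT_fin; last by move=> t; exact: cylinder_mass_ge0.
have mC (t : n.-tuple A) : (fine (mu (@cylinder A T t)))%:E = mu (@cylinder A T t).
  by rewrite fineK ?fin_num_measure//; exact: measurable_cylinder.
under eq_esum do rewrite mC.
rewrite esum_fset; [|exact: finite_finset|by []].
rewrite -measure_fin_bigcup.
- rewrite -[RHS](probability_setT mu); congr (mu _).
  apply/seteqP; split=> // w _; exists (initial_word n w) => //.
  by rewrite /cylinder /= size_mkseq.
- exact: finite_finset.
- move=> t u _ _ [w [tw uw]]; apply: val_inj.
  by rewrite /= -tw -uw !size_tuple.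
- by move=> t _; exact: measurable_cylinder.
Qed.

Lemma sum_cylinder_mass_pair n m :
  \sum_(p : n.-tuple A * m.-tuple A) fine (mu (@cylinder A T p.1)) = #|{: A}|%:R ^+ m.
Proof.
rewrite -(pair_bigA _ (fun (t : n.-tuple A) (u : m.-tuple A) =>
  fine (mu (@cylinder A T t)))) /=.
under eq_bigr do rewrite sumr_const card_tuple.
by rewrite sumrMnl sum_cylinder_mass natrX.
Qed.

(** On a null cylinder [ln] would return its default value 0; [mass_gt0] below, a consequence of the
    weak Gibbs lower bound, excludes this for positive [n]. *)
Definition log_mass n (w : markov_shift T) : R :=
  ln (fine (mu (@cylinder A T (mkseq w n)))).

(** The function is constant on each cylinder of length [n], which is open. *)
Lemma continuous_log_mass n : continuous (log_mass n).
Proof.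
move=> w; apply: (@cvg_near_cst _ _ _ _ _ (nbhs_filter w)).
have : nbhs w (@cylinder A T (mkseq w n)).
  by apply: open_nbhs_nbhs; split; [exact: open_cylinder|exact: cylinder_mkseq].
by apply: filterS => v; rewrite /cylinder /= size_mkseq /log_mass => ->.
Qed.

Hypothesis mass_gt0 : forall n (w : markov_shift T), (0 < n)%N ->
  0 < fine (mu (@cylinder A T (mkseq w n))).

Lemma expR_log_mass n w : (0 < n)%N ->
  expR (log_mass n w) = fine (mu (@cylinder A T (mkseq w n))).
Proof. by move=> n0; rewrite lnK// posrE mass_gt0. Qed.

Lemma pressure_at_log_mass_ge1 n (eps : R) : (0 < n)%N -> eps < 2^-1 ->
  (1 <= pressure_at log_mass n eps)%E.
Proof.
move=> n0 eps2.
pose D := [set t : n.-tuple A | @cylinder A T t !=set0].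
pose rep (t : n.-tuple A) := xget w0 (@cylinder A T t).
have repP t : D t -> mkseq (rep t) n = t.
  move=> Dt; have : @cylinder A T t (rep t) := xgetPex w0 Dt.
  by rewrite /cylinder /= size_tuple.
have rep_inj : set_inj D rep.
  by move=> t u /set_mem Dt /set_mem Du e; apply: val_inj; rewrite /= -repP// e repP.
apply: le_ereal_sup_tmp; eexists.
  exists (rep @` D) => // _ _ [t Dt <-] [u Du <-] tu.
  have [i /= ti ui] : exists2 i, (i < n)%N & rep t i <> rep u i.
    apply: contrapT => ne; apply: tu; congr rep; apply: val_inj.
    rewrite /= -repP// -[RHS]repP//; apply/eq_mkseqP => i ti.
    by apply: contrapT => ?; apply: ne; exists i.
  apply: (lt_le_trans eps2).
  apply: (bigmax_sup (Ordinal ti)) => //.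
  by apply: shift_dist_disagree; rewrite !iter_shift addn0; apply/eqP.
rewrite esum_image// -(sum_cylinder_mass n) -esum_setT_fin; last first.
  by move=> t; exact: cylinder_mass_ge0.
(* Words outside [D] have empty cylinders of mass 0, so the sum over [D] is the full sum 1. *)
rewrite [leRHS]esum_mkcond; apply: le_esum => t _.
case: ifPn => [/set_mem Dt|/negP Dt]; first by rewrite expR_log_mass// repP.
have -> : @cylinder A T t = set0 by apply: contrapT => /eqP/set0P h; apply/Dt/mem_set.
by rewrite measure0.
Qed.

Lemma pressure_at_log_mass_le (eps : R) : 0 < eps ->
  exists m, forall n, (0 < n)%N ->
  (pressure_at log_mass n eps <= (#|{: A}|%:R ^+ m)%:E)%E.
Proof.
move=> e0; have [D D0 hD] := shift_dist_agree R T.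
(* This choice gives D / eps < 2^m. *)
pose m := Num.bound (D / eps); exists m => n n0.
have Dm : D / 2 ^+ m <= eps.
  rewrite ler_pdivrMr ?exprn_gt0// mulrC -ler_pdivrMr// ltW//.
  exact: upper_nthrootP.
apply: ge_ereal_sup => _ [E sepE <-].
(* [q w] records the first [n + m] letters of [w], split so that the weight depends on the first
   component only. *)
pose q (w : markov_shift T) :=
  (initial_word n w, initial_word m (iter n (@shift_map A T) w)).
under eq_esum do rewrite expR_log_mass//.
rewrite -(sum_cylinder_mass_pair n m).
apply: (esum_inj_le (fun p => cylinder_mass_ge0 p.1) (q := q)).
move=> w v /set_mem Ew /set_mem Ev qwv.
have /eq_mkseqP wv1 : mkseq w n = mkseq v n := congr1 (fun p => tval p.1) qwv.
have /eq_mkseqP wv2 := congr1 (fun p => tval p.2) qwv.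
(* If [w] and [v] share [n + m] letters, their shifts by any i < n share [m] letters, hence lie
   within [eps], against separation. *)
apply: contrapT => /(sepE _ _ Ew Ev); apply/negP; rewrite -leNgt.
apply: bigmax_le => [|i _]; first exact: ltW.
apply: le_trans Dm; apply: hD => j jm; rewrite !iter_shift.
case: (ltnP (i + j) n) => [/wv1//|nij].
have := wv2 (i + j - n)%N; rewrite !iter_shift subnKC//; apply.
by rewrite ltn_subLR// -addnS leq_add// ltnW.
Qed.

(** For each fixed [eps] below 1/2 the normalised logarithms lie between 0 and c / n, so the upper
    limit is 0 before [eps] even tends to 0. *)
Lemma pressure_log_mass : pressure log_mass = 0.
Proof.
rewrite /pressure; apply: cvg_lim => //; apply: cvg_near_cst.
near=> eps.
have e0 : 0 < eps by near: eps; exact: nbhs_right_gt.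
have e2 : eps < 2^-1 by near: eps; apply: nbhs_right_lt; rewrite invr_gt0.
have [m hm] := pressure_at_log_mass_le e0.
pose c : R := ln (#|{: A}|%:R ^+ m).
suff /cvg_limn_einf_sup[] : (fun n => (n%:R^-1)%:E * lne (pressure_at log_mass n eps))%E
   @ \oo --> 0%E by [].
apply: (@squeeze_cvge _ _ _ _ (cst 0%E) _ (fun n => (n%:R^-1 * c)%:E)).
- near=> n.
  have n0 : (0 < n)%N by near: n; exact: nbhs_infty_gt.
  have ge1 := pressure_at_log_mass_ge1 n0 e2.
  have A0 : 0 < #|{: A}|%:R ^+ m :> R.
    by rewrite exprn_gt0// ltr0n; apply/card_gt0P; exists (w0 0%N).
  rewrite mule_ge0 ?lee_fin ?invr_ge0//= ?lne_ge0//.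
  rewrite EFinM lee_wpmul2l ?lee_fin ?invr_ge0//.
  rewrite -lne_EFin// lee_lne ?hm// in_itv/= leey ?andbT ?lee_fin ?(ltW A0)//.
  exact: le_trans ge1.
- exact: cvg_cst.
- apply: cvg_EFin; first exact: nearW.
  (* [harmonic] is 1 / (n + 1), hence the shift of index. *)
  rewrite -cvg_shiftS.
  have : @harmonic R n * c @[n --> \oo] --> 0 * c.
    by apply: cvgM; [exact: cvg_harmonic|exact: cvg_cst].
  by rewrite mul0r.
Unshelve. all: by end_near. Qed.

End Mass.

Theorem corollary2p1 (R : realType) (A : {fset int}) (T : 'M[nat]_#|{: A}|)
    (hT : zero_one T) (hmix : topologically_mixing T)
    (w0 : markov_shift T) (mu : probability (borel_shift w0) R)
    (phi : markov_shift T -> R) (hphi : continuous phi)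
    (hmu : weak_gibbs mu phi) :
  exists psi : nat -> markov_shift T -> R,
    asymptotically_additive psi /\ gibbs mu psi.
Proof.
have [P [K [K0 lnK0 wg]]] := hmu.
have mass_gt0 n (w : markov_shift T) : (0 < n)%N ->
    0 < fine (mu (@cylinder A T (mkseq w n))).
  move=> n0; have /andP[+ _] := wg n _ w n0 (size_mkseq _ _) (cylinder_mkseq w n).
  rewrite ler_pdivlMr ?expR_gt0//; apply: lt_le_trans.
  by rewrite mulr_gt0 ?invr_gt0 ?K0 ?expR_gt0.
have press0 := pressure_log_mass mass_gt0.
exists (log_mass mu); split; first split.
- by move=> n _; exact: continuous_log_mass.
(* One function serves every [eps]; subtracting [P] matches the normalisation to zero pressure. *)
- move=> eps eps0; exists (fun w => phi w - P).
    by move=> w; apply: cvgB (hphi w) (cvg_cst _).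
  set u := (X in limn_esup X).
  suff /cvg_limn_einf_sup[_ ->] : u @ \oo --> 0%E by rewrite lte_fin.
  apply: (@squeeze_cvge _ _ _ _ (cst 0%E) _ (fun n => (ln (K n) / n%:R)%:E)).
  + near=> n.
    have n0 : (0 < n)%N by near: n; exact: nbhs_infty_gt.
    (* Taking logarithms in both weak Gibbs inequalities bounds the difference by [ln (K n)],
       uniformly in the point. *)
    have ub : ubound (range (fun w => `|(log_mass mu n \- birkhoff n (fun w => phi w - P)) w|))
        (ln (K n)).
      move=> _ [w _ <-] /=.
      have -> : birkhoff n (fun w => phi w - P) w = birkhoff n phi w - n%:R * P.
        by rewrite /birkhoff sumrB sumr_const card_ord mulr_natl.
      have := wg n _ w n0 (size_mkseq _ _) (cylinder_mkseq w n).
      rewrite -expR_log_mass// -expRB -[K n]lnK ?posrE ?K0// -expRN !ler_expR.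
      by rewrite expRK ler_norml.
    pose f w := `|(log_mass mu n \- birkhoff n (fun w => phi w - P)) w|.
    (* The base point makes the range nonempty, so its supremum is a genuine one and dominates the
       nonnegative value [f w0]. *)
    have f_w0 : range f (f w0) by exists w0.
    rewrite /= !lee_fin; apply/andP; split.
      rewrite mulr_ge0 ?invr_ge0//; apply: (@le_trans _ _ (f w0)); first exact: normr_ge0.
      by apply: ub_le_sup f_w0; exists (ln (K n)).
    by rewrite mulrC ler_wpM2r ?invr_ge0//; apply: ge_sup => //; exists (f w0).
  + exact: cvg_cst.
  + apply: cvg_EFin; first exact: nearW.
    exact: lnK0.
- split; first by rewrite press0.
  exists 1 => // n s w n0 sn ws; rewrite press0 mulr0 subr0 expR_log_mass//.
  have -> : mkseq w n = s by rewrite -sn.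
  by rewrite divff ?invr1 ?lexx// -ws sn gt_eqF// mass_gt0.
Unshelve. all: by end_near. Qed.
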